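(* Let $G=(V,E)$ with weight $\mu$ be an infinite, connected, locally finite weighted graph satisfying condition $(p_0)$, let $m>1$, and fix $o\in V$. Let $(p,q)\in G_3=\{(p,q): p<0,\ m-1<q<m\}$. Suppose there exist constants $C>0$ and $n_1$ such that $$W_o(n)\le C\, n^{\frac{q}{q-m+1}}(\ln n)^{\frac{m-1}{q-m+1}}\quad\text{for all } n\ge n_1.$$ Then the inequality $\Delta_m u+u^p|\nabla u|^q\le 0$ on $V$ admits no nontrivial positive solution.
   Context: Setting: $G=(V,E)$ is an infinite, connected, locally finite graph with no loops and no multiple edges; $x\sim y$ means $x$ and $y$ are joined by an edge. A weight is a symmetric function $\mu:V\times V\to[0,\infty)$ with $\mu_{xy}=\mu_{yx}>0$ if and only if $x\sim y$; the vertex measure is $\mu(x)=\sum_{y\sim x}\mu_{xy}$. For $m>1$ and $u:V\to\mathbb R$, $\Delta_m u(x)=\frac{1}{\mu(x)}\sum_{y\sim x}\mu_{xy}|u(y)-u(x)|^{m-2}(u(y)-u(x))$ and $|\nabla u(x)|=\big(\sum_{y\sim x}\frac{\mu_{xy}}{2\mu(x)}(u(y)-u(x))^2\big)^{1/2}$. Condition $(p_0)$: there is a constant $p_0>1$ such that $\mu_{xy}/\mu(x)\ge 1/p_0$ for all $x\sim y$. $d(x,y)$ is the graph (shortest path) distance, $B(o,n)=\{x\in V: d(o,x)\le n\}$, and $W_o(n)=\sum_{x\in B(o,n),\,y\in V,\,d(o,x)<d(o,y)}\mu_{xy}$. A nontrivial positive solution of $\Delta_m u+u^p|\nabla u|^q\le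 0$ is a non-constant function $u:V\to(0,\infty)$ such that $\Delta_m u(x)+u(x)^p|\nabla u(x)|^q\le 0$ for every $x\in V$, with the conventions $0^0=1$, $0^q=0$ for $q>0$, and, for $q<0$, $|\nabla u(x)|^q=+\infty$ when $|\nabla u(x)|=0$ (so the inequality fails at such $x$). *)

(* Defs.v *)
From HB Require Import structures.
From mathcomp Require Import all_boot all_order all_algebra.
From mathcomp Require Import all_classical all_reals all_analysis.
Set Implicit Arguments. Unset Strict Implicit. Unset Printing Implicit Defensive.
Import Order.TTheory GRing.Theory Num.Theory.
Local Open Scope classical_set_scope.
Local Open Scope ring_scope.

Section GraphDefs.
Context {V : choiceType} (E : rel V).

Definition walk_len (x y : V) (k : nat) : Prop :=
  exists s : seq V, size s = k /\ path E x s /\ last x s = y.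

Definition connected_graph : Prop := forall x y : V, exists k, walk_len x y k.

(* graph (shortest path) distance; 0 if unreachable (never happens when connected) *)
Definition gdist (x y : V) : nat :=
  match pselect (exists k, `[< walk_len x y k >]) with
  | left P => ex_minn P
  | right _ => 0%N
  end.

Definition simple_graph : Prop := (forall x, ~~ E x x) /\ (forall x y, E x y = E y x).
Definition locally_finite : Prop := forall x, finite_set [set y | E x y].

Context {R : realType} (mu : V -> V -> R).

Definition is_weight : Prop :=
  (forall x y, mu x y = mu y x) /\ (forall x y, 0 <= mu x y) /\
  (forall x y, 0 < mu x y <-> E x y).

Definition vmeas (x : V) : R := \sum_(y \in [set y | E x y]) mu x y.

Definition cond_p0 (p0 : R) : Prop :=
  1 < p0 /\ forall x y, E x y -> 1 / p0 <= mu x y / vmeas x.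

Definition mlap (m : R) (u : V -> R) (x : V) : R :=
  (vmeas x)^-1 * \sum_(y \in [set y | E x y])
     mu x y * (`|u y - u x| `^ (m - 2) * (u y - u x)).

Definition gradn (u : V -> R) (x : V) : R :=
  Num.sqrt (\sum_(y \in [set y | E x y])
     mu x y / (2 * vmeas x) * (u y - u x) ^+ 2).

Definition Wvol (o : V) (n : nat) : R :=
  \sum_(xy \in [set xy : V * V | (gdist o xy.1 <= n)%N /\
                                 (gdist o xy.1 < gdist o xy.2)%N])
     mu xy.1 xy.2.

(* nontrivial positive solution of Delta_m u + u^p |grad u|^q <= 0, for q > 0
   (so the conventions 0^q = 0 agree with powR) *)
Definition nontriv_pos_sol (m p q : R) (u : V -> R) : Prop :=
  (forall x, 0 < u x) /\ (exists x y, u x != u y) /\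
  (forall x, mlap m u x + u x `^ p * gradn u x `^ q <= 0).

End GraphDefs.

Definition infinite_graph (V : choiceType) : Prop := infinite_set [set: V].

(* Main.v *)
(** Truncating u at a level M turns it into a bounded non-constant v with
   - mu(x) Delta_m v(x) >= c e(x), where e(x) = sum_y mu_xy |v(x) - v(y)|^q:
   where u <= M one has u^p >= M^p because p < 0, and where u > M all
   differences v(x) - v(y) lie in [0, M] and m - 1 < q.
   Put q = (m - 1)(1 + s), so that (1 + s) / s and 1 / s are the exponents of
   the volume bound.  Summing over B(o,n), the antisymmetric flux cancels
   except along the edges leaving the sphere S_n, of total weight w_n; with
   I_n = c sum_{B(o,n)} e, Hoelder gives
   I_n^(1+s) <= K (I_n - I_{n-1}) w_n^s, whence
   I_{n-1}^(-s) - I_n^(-s) >= c' w_n^(-s).  Over a dyadic block (N, 2N] the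
   volume bound and convexity make the sum of the right-hand sides at least
   c'' / ln(2N); summed over N = 2^j this diverges like the harmonic series,
   while the left-hand sides telescope to a bounded quantity. *)
Require Import Defs.
From HB Require Import structures.
From mathcomp Require Import all_boot all_order all_algebra.
From mathcomp Require Import all_classical all_reals all_analysis.
From mathcomp Require Import ring lra zify.
Import Order.TTheory GRing.Theory Num.Theory.
Local Open Scope classical_set_scope.
Local Open Scope ring_scope.

Set Implicit Arguments.
Unset Strict Implicit.

(** * Tangent-line and Young inequalities for real powers *)

(** Scaling to [x / t] reduces this to Bernoulli's inequality, which follows from [ln r <= r - 1]
    and [1 + z <= expR z]. *)
Lemma powRN_tangent (R : realType) (s x t : R) : 0 < s -> 0 < x -> 0 < t ->
  t `^ (- s) - s * t `^ (- s - 1) * (x - t) <= x `^ (- s).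
Proof.
move=> s0 x0 t0.
have bern (r : R) : 0 < r -> 1 - s * (r - 1) <= r `^ (- s).
  move=> r0; have lnr : ln r <= r - 1.
    by rewrite -[in ln r](subrKC 1 r); apply: le_ln1Dx; lra.
  rewrite /powR gt_eqF//; apply: le_trans (expR_ge1Dx _).
  by have := ler_wpM2l (ltW s0) lnr; lra.
have := bern (x / t) (divr_gt0 x0 t0).
move/(ler_wpM2r (powR_ge0 t (- s))).
rewrite -powRM ?(divr_ge0 (ltW x0))// ?(ltW t0)// divfK ?gt_eqF//; apply: le_trans.
rewrite powRD; last by rewrite (gt_eqF t0) implybT.
rewrite powR_inv1 ?(ltW t0)// mulrBl mul1r lerD2l lerN2 le_eqVlt; apply/orP; left.
by apply/eqP; field; rewrite gt_eqF.
Qed.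

(** For [a > 0] this is the tangent bound with base point [a], evaluated at [t] and multiplied by
    [a^(1+s) t^s]. *)
Lemma powR_young (R : realType) (s a t : R) : 0 < s -> 0 <= a -> 0 < t ->
  (1 + s) * t `^ s * a <= a `^ (1 + s) + s * t `^ (1 + s).
Proof.
move=> s0; rewrite le_eqVlt => /predU1P[<- t0|a0 t0].
  by rewrite mulr0 addr_ge0 ?powR_ge0// mulr_ge0 ?powR_ge0// ltW.
have := @powRN_tangent R s t a s0 t0 a0.
rewrite !powRD ?(gt_eqF t0) ?(gt_eqF a0) ?implybT// !powRN.
rewrite !powRr1 ?(ltW t0) ?(ltW a0)//.
have := powR_gt0 s a0; have := powR_gt0 s t0.
move: (a `^ s) (t `^ s) => P Q Q0 P0 h.
have := ler_wpM2l (ltW (mulr_gt0 (mulr_gt0 P0 Q0) a0)) h.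
have -> : P * Q * a * (P^-1 - s * (P^-1 * a^-1) * (t - a)) =
    Q * a - s * Q * (t - a) by field; rewrite !gt_eqF.
have -> : P * Q * a * Q^-1 = a * P by field; rewrite gt_eqF.
lra.
Qed.

(* The tangent line of x^(-s) at b bounds the right-hand side from below; the
   hypothesis is used at t = b / th, where th will be the mean weight of a
   sphere in the block, so that Hoelder over the block is not needed. *)
Lemma power_flow_step (R : realType) (s K a b w th : R) :
  0 < s -> 0 < K -> 0 < th -> 0 < a -> 0 < b ->
  (forall t, 0 < t ->
     (1 + s) * t `^ s * b <= K * (b - a) + s * t `^ (1 + s) * w) ->
  (1 + s) * th `^ (- s) - s * (th `^ (- s) / th) * w <=
    K / s * (a `^ (- s) - b `^ (- s)).
Proof.
move=> s0 K0 th0 a0 b0 /(_ _ (divr_gt0 b0 th0)).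
have thV0 : 0 < th^-1 by rewrite invr_gt0.
rewrite powRD; last by rewrite (gt_eqF (divr_gt0 b0 th0)) implybT.
rewrite powRr1; last exact/ltW/divr_gt0.
have -> : (b / th) `^ s = b `^ s / th `^ s.
  by rewrite powRM ?(ltW b0) ?(ltW thV0)// -powR_inv1 ?(ltW th0)// -powRrM mulN1r powRN.
have := @powRN_tangent R s a b s0 a0 b0.
rewrite powRD; last by rewrite (gt_eqF b0) implybT.
rewrite powR_inv1 ?(ltW b0)// !powRN.
have := powR_gt0 s b0; have := powR_gt0 s th0; move: (a `^ s)^-1 => J.
move: (b `^ s) (th `^ s) => B T T0 B0 tangent flow.
have B0' := lt0r_neq0 B0; have T0' := lt0r_neq0 T0.
have b0' := lt0r_neq0 b0; have th0' := lt0r_neq0 th0; have s0' := lt0r_neq0 s0.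
have := ler_wpM2l (ltW (divr_gt0 K0 s0)) tangent.
have BbV : 0 < (B * b)^-1 by rewrite invr_gt0 mulr_gt0.
have := ler_wpM2l (ltW BbV) flow.
have -> : (B * b)^-1 * ((1 + s) * (B / T) * b) = (1 + s) * T^-1.
  by field; rewrite ?B0' ?T0' ?b0'.
have -> : (B * b)^-1 * (K * (b - a) + s * (b / th * (B / T)) * w) =
    K * (b - a) / (B * b) + s * (T^-1 / th) * w.
  by field; rewrite ?B0' ?T0' ?b0' ?th0'.
have -> : K / s * (B^-1 - s * (B^-1 / b) * (a - b)) =
    K / s * B^-1 + K * (b - a) / (B * b).
  by field; rewrite ?B0' ?s0' ?b0'.
lra.
Qed.

(** * Sequences obeying the flow inequality *)

(** Summing the one-step bounds telescopes the right-hand side. Since [th] bounds the mean weight,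
    the linear terms cost at most [s k th^(-s)] out of [(1 + s) k th^(-s)]. *)
Lemma power_flow_block (R : realType) (s K : R) (I w : nat -> R) (n k : nat) (th : R) :
  0 < s -> 0 < K -> 0 < th ->
  (forall i, I i <= I i.+1) -> 0 < I n ->
  (forall i t, 0 < t ->
     (1 + s) * t `^ s * I i.+1 <=
       K * (I i.+1 - I i) + s * t `^ (1 + s) * w i.+1) ->
  \sum_(n <= i < n + k) w i.+1 <= k%:R * th ->
  k%:R * th `^ (- s) <= K / s * (I n `^ (- s) - I (n + k)%N `^ (- s)).
Proof.
move=> s0 K0 th0 Inc In flow sumw.
have I0 i : 0 < I (n + i)%N.
  elim: i => [|i IH]; first by rewrite addn0.
  by rewrite addnS; apply: lt_le_trans IH (Inc _).
set T := th `^ (- s); set W := \sum_(_ <= _ < _) _ in sumw.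
have T0 : 0 < T by exact: powR_gt0.
have : (1 + s) * T * k%:R - s * (T / th) * W <=
    K / s * (I n `^ (- s) - I (n + k)%N `^ (- s)).
  rewrite /W; elim: k {sumw W} => [|k IH].
    by rewrite addn0 big_geq// !mulr0 !subrr mulr0.
  rewrite addnS big_nat_recr ?leq_addr//= -natr1.
  have h : 0 < I (n + k).+1 by rewrite -addnS.
  have := power_flow_step s0 K0 th0 (I0 k) h (flow _).
  by move: IH; rewrite -/T; lra.
have := ler_wpM2l (ltW (mulr_gt0 s0 (divr_gt0 T0 th0))) sumw.
have -> : s * (T / th) * (k%:R * th) = s * T * k%:R by field; rewrite gt_eqF.
lra.
Qed.

Lemma flow_growth_false (R : realType) (s K C : R) (I w : nat -> R) (n0 n1 : nat) :
  0 < s -> 0 < K -> 0 < C ->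
  (forall i, I i <= I i.+1) -> 0 < I n0 -> (forall i, 0 <= w i) ->
  (forall i t, 0 < t ->
     (1 + s) * t `^ s * I i.+1 <=
       K * (I i.+1 - I i) + s * t `^ (1 + s) * w i.+1) ->
  (forall n, (n1 <= n)%N -> \sum_(i < n.+1) w i <=
     C * n%:R `^ ((1 + s) / s) * ln (n%:R) `^ (1 / s)) ->
  False.
Proof.
move=> s0 K0 C0 Inc In0 w0 flow growth.
have I0 i : (n0 <= i)%N -> 0 < I i.
  elim: i => [|i IH]; first by rewrite leqn0 => /eqP <-.
  rewrite leq_eqVlt => /predU1P[<-//|/IH h]; exact: lt_le_trans h (Inc _).
have ln20 : 0 < ln (2 : R) by apply: ln_gt0; lra.
pose J i := I i `^ (- s).
pose c := C `^ s * 2 `^ (1 + s) * ln 2 * (K / s).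
have c0 : 0 < c by rewrite !mulr_gt0 ?powR_gt0// invr_gt0.
have block j : (n0 + n1 <= j)%N -> (j.+1%:R)^-1 <= c * (J (2 ^ j)%N - J (2 ^ j.+1)%N).
  move=> jn; pose N := (2 ^ j)%N.
  have jN : (j < N)%N by exact: ltn_expl.
  have N0 : 0 < N%:R :> R by rewrite ltr0n; lia.
  have N20 : 0 < (N + N)%:R :> R by rewrite ltr0n; lia.
  have lnN : ln ((N + N)%:R : R) = j.+1%:R * ln 2.
    by rewrite addnn -mul2n -expnS natrX lnXn// mulr_natl.
  have L0 : 0 < j.+1%:R * ln (2 : R) by rewrite mulr_gt0.
  (* The volume bound at radius [2N], with [ln (2N) = (j+1) ln 2]. It majorises the total weight of
     the block, so [Wh / N] can serve as [th]. *)
  pose Wh := C * (N + N)%:R `^ ((1 + s) / s) * (j.+1%:R * ln 2) `^ (1 / s).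
  have Wh0 : 0 < Wh by rewrite !mulr_gt0 ?powR_gt0.
  have := @power_flow_block R s K I w N N (Wh / N%:R) s0 K0 (divr_gt0 Wh0 N0) Inc.
  move=> /(_ (I0 _ _) flow); rewrite mulrCA divff ?mulr1 ?(lt0r_neq0 N0)//.
  have Nn0 : (n0 <= N)%N by lia.
  have sumW : \sum_(N <= i < N + N) w i.+1 <= Wh.
    apply: (@le_trans _ _ (\sum_(i < (N + N).+1) w i)); last first.
      by rewrite /Wh -lnN; apply: growth; lia.
    rewrite -(big_mkord xpredT w) [leRHS](@big_cat_nat _ _ _ N.+1)//=; last by lia.
    by rewrite big_add1 /= lerDr sumr_ge0.
  move=> /(_ Nn0 sumW).
  (* Here the critical exponents enter: [Wh^s] carries [(2N)^(1+s)] and the first power of the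
     logarithm, so all powers of [N] cancel and only [1 / (j+1)] remains. *)
  have -> : N%:R * (Wh / N%:R) `^ (- s) =
      (j.+1%:R)^-1 / (C `^ s * 2 `^ (1 + s) * ln 2).
    have NV : 0 <= (N%:R)^-1 :> R by rewrite invr_ge0 ltW.
    rewrite powRN powRM ?(ltW Wh0)//.
    rewrite /Wh powRM ?powR_ge0 ?mulr_ge0 ?powR_ge0 ?(ltW C0)//.
    rewrite powRM ?powR_ge0 ?(ltW C0)// -!powRrM.
    rewrite divfK ?(lt0r_neq0 s0)// div1r mulVf ?(lt0r_neq0 s0)// powRr1 ?(ltW L0)//.
    rewrite addnn -mul2n natrM powRM ?(ltW N0)//.
    rewrite (@powRD _ N%:R); last by rewrite (gt_eqF N0) implybT.
    rewrite powRr1 ?(ltW N0)// -(@powR_inv1 _ N%:R) ?(ltW N0)// -(powRrM N%:R) mulN1r powRN.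
    by field; rewrite ?gt_eqF ?powR_gt0.
  have X0 : 0 < C `^ s * 2 `^ (1 + s) * ln 2 by rewrite !mulr_gt0 ?powR_gt0.
  move/(ler_wpM2l (ltW X0)); rewrite [leLHS]mulrCA divff ?gt_eqF// mulr1.
  by rewrite mulrA /c /J expnS mul2n -addnn.
pose j0 := (n0 + n1)%N.
(* As [ln (1 + 1/a) <= 1/a], [block] makes this quantity nonincreasing; the logarithm stands in for
   the harmonic sums. *)
have potential k : ln (j0 + k).+1%:R + c * J (2 ^ (j0 + k))%N <=
    ln j0.+1%:R + c * J (2 ^ j0)%N.
  elim: k => [|k]; first by rewrite addn0.
  apply: le_trans; rewrite addnS.
  have := block (j0 + k)%N (leq_addr _ _).
  set a : R := (j0 + k).+1%:R; have a0 : 0 < a by rewrite ltr0n.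
  have -> : ln ((j0 + k).+2%:R : R) = ln a + ln (1 + a^-1).
    rewrite -lnM ?posrE ?addr_gt0 ?invr_gt0// mulrDr mulr1 divff ?gt_eqF//.
    by rewrite natr1.
  have : ln (1 + a^-1) <= a^-1.
    by apply: le_ln1Dx; rewrite (lt_trans (ltrN10 R))// invr_gt0.
  rewrite mulrBr; move: a^-1 (ln (1 + _)) (ln a) (c * _) (c * _) => r l la x y; lra.
pose D := ln j0.+1%:R + c * J (2 ^ j0)%N.
have := potential (Num.Def.archi_bound (expR D)).
apply/negP; rewrite -ltNge -/D.
have := archi_boundP (expR_ge0 D); set k := Num.Def.archi_bound _ => Dk.
have Dk' : D < ln (j0 + k).+1%:R.
  rewrite -[ltLHS]expRK ltr_ln ?posrE ?expR_gt0 ?ltr0n//.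
  by apply: lt_le_trans Dk _; rewrite ler_nat; lia.
by apply: ltr_wpDr Dk'; rewrite mulr_ge0 ?powR_ge0// ltW.
Qed.

(** * Neighbour lists, balls and the scalar flux *)

Definition nbrs (V : choiceType) (E : rel V) (x : V) : seq V :=
  finmap.enum_fset (fset_set [set y | E x y]).

Definition ball (V : choiceType) (E : rel V) (o : V) (n : nat) : seq V :=
  finmap.enum_fset (fset_set [set x | (gdist E o x <= n)%N]).

(** The factor [d] forces the value 0 at [d = 0], also when [m < 2]. *)
Definition pflux (R : realType) (m d : R) : R := `|d| `^ (m - 2) * d.

Lemma pfluxN (R : realType) (m d : R) : pflux m (- d) = - pflux m d.
Proof. by rewrite /pflux normrN mulrN. Qed.

Lemma pflux_ge0E (R : realType) (m d : R) : 1 < m -> 0 <= d ->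
  pflux m d = d `^ (m - 1).
Proof.
move=> m1; rewrite le_eqVlt /pflux => /predU1P[<-|d0].
  by rewrite mulr0 powR0// subr_eq0 gt_eqF.
rewrite gtr0_norm// (_ : m - 1 = m - 2 + 1); last by ring.
by rewrite [RHS]powRD ?(gt_eqF d0) ?implybT// powRr1// ltW.
Qed.

Lemma le_pflux (R : realType) (m : R) : 1 < m ->
  {homo pflux m : a b / a <= b}.
Proof.
move=> m1 a b ab; have mono x y : 0 <= x -> x <= y -> pflux m x <= pflux m y.
  move=> x0 xy; have y0 := le_trans x0 xy.
  by rewrite !pflux_ge0E// ge0_ler_powR ?nnegrE// subr_ge0 ltW.
have [a0|a0] := leP 0 a; first exact: mono.
have [b0|b0] := leP 0 b.
  apply: (@le_trans _ _ 0).
    by rewrite /pflux mulr_ge0_le0 ?powR_ge0// ltW.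
  by rewrite /pflux mulr_ge0 ?powR_ge0.
by rewrite -[a]opprK -[b]opprK !(pfluxN _ (- _)) lerN2 mono ?lerN2// oppr_ge0 ltW.
Qed.

(** * Graph distance and finiteness of balls *)

Section Graph.
Context (V : choiceType) (E : rel V).
Context (simpE : simple_graph E) (connE : connected_graph E)
  (finE : locally_finite E).

Lemma mem_nbrs x y : (y \in nbrs E x) = E x y.
Proof.
rewrite in_fset_set; last exact: finE.
by apply/idP/idP; rewrite inE.
Qed.

Lemma gdist_walk o x : walk_len E o x (gdist E o x).
Proof.
rewrite /gdist; case: pselect => [P|[]]; last first.
  by have [k kP] := connE o x; exists k; apply/asboolP.
by case: ex_minnP => k /asboolP.
Qed.

Lemma gdist_min o x k : walk_len E o x k -> (gdist E o x <= k)%N.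
Proof.
move=> wk; rewrite /gdist; case: pselect => [P|//].
by case: ex_minnP => j _; apply; apply/asboolP.
Qed.

Lemma gdist_edge o x y : E x y -> (gdist E o y <= (gdist E o x).+1)%N.
Proof.
move=> xy; have [s [sz [ps ls]]] := gdist_walk o x; apply: gdist_min.
exists (rcons s y); rewrite size_rcons sz; split=> //.
by rewrite rcons_path ps ls xy last_rcons.
Qed.

(** Endpoints of walks of length [k + 1] are neighbours of endpoints of walks of length [k], so
    local finiteness propagates by induction. *)
Lemma finite_ball o n : finite_set [set x | (gdist E o x <= n)%N].
Proof.
have fin_walk k : finite_set [set x | walk_len E o x k].
  elim: k => [|k IH].
    apply: (@sub_finite_set _ _ [set o]); last exact: finite_set1.
    by move=> x [s [/size0nil -> [_ /= ->]]].
  apply: (@sub_finite_set _ _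
    (\bigcup_(x in [set x | walk_len E o x k]) [set y | E x y])).
    move=> y [s]; case/lastP: s => [[]//|s z]; rewrite size_rcons last_rcons.
    rewrite rcons_path => -[[sz] [/andP[ps lz] <-]].
    by exists (last o s) => //; exists s.
  by apply: bigcup_finite => // x _; exact: finE.
apply: (@sub_finite_set _ _ (\bigcup_(k in `I_n.+1) [set x | walk_len E o x k])).
  by move=> x xn; exists (gdist E o x) => //; exact: gdist_walk.
by apply: bigcup_finite => // k _.
Qed.

Lemma mem_ball o n x : (x \in ball E o n) = (gdist E o x <= n)%N.
Proof.
rewrite in_fset_set; last exact: finite_ball.
by apply/idP/idP; rewrite inE.
Qed.

Lemma uniq_ball o n : uniq (ball E o n).
Proof. exact: finmap.fset_uniq. Qed.

Lemma uniq_nbrs x : uniq (nbrs E x).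
Proof. exact: finmap.fset_uniq. Qed.

Lemma sum_ballS (R : realType) o n (f : V -> R) :
  \sum_(x <- ball E o n.+1) f x =
  \sum_(x <- ball E o n) f x +
  \sum_(x <- ball E o n.+1 | gdist E o x == n.+1) f x.
Proof.
rewrite [LHS](bigID (fun x => gdist E o x == n.+1)) /= addrC; congr (_ + _).
rewrite -big_filter; apply: perm_big; apply: uniq_perm.
- by rewrite filter_uniq// uniq_ball.
- exact: uniq_ball.
- by move=> x; rewrite mem_filter !mem_ball; lia.
Qed.

Lemma sum_ball_spheres (R : realType) o n (f : V -> R) :
  \sum_(x <- ball E o n) f x =
  \sum_(k < n.+1) \sum_(x <- ball E o k | gdist E o x == k) f x.
Proof.
elim: n => [|n IH]; last by rewrite sum_ballS IH [RHS]big_ord_recr.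
rewrite big_ord1 /= big_seq [RHS]big_seq_cond.
by apply: eq_bigl => x; rewrite mem_ball leqn0 andbb.
Qed.

(** * Summation over spheres and Green's formula *)

Section Weight.
Context (R : realType) (mu : V -> V -> R).

Definition energy (q : R) (v : V -> R) (x : V) : R :=
  \sum_(y <- nbrs E x) mu x y * `|v x - v y| `^ q.

Definition out_weight (o x : V) : R :=
  \sum_(y <- nbrs E x | (gdist E o x < gdist E o y)%N) mu x y.

(** This is [- mu(x) Delta_m v(x)], cleared of the division by the vertex measure. *)
Definition flux (m : R) (v : V -> R) (x : V) : R :=
  \sum_(y <- nbrs E x) mu x y * pflux m (v x - v y).

(** The set defining [Wvol] also contains non-adjacent pairs and may be infinite; they have weight
    0, so the sum reduces to a finite list of edges. *)
Lemma Wvol_spheres o n :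
  is_weight E mu ->
  Wvol E mu o n = \sum_(k < n.+1) \sum_(x <- ball E o k | gdist E o x == k) out_weight o x.
Proof.
move=> [_ [mu0 muE]]; rewrite -sum_ball_spheres /Wvol.
pose r := [seq xy <- [seq (x, y) | x <- ball E o n, y <- nbrs E x]
          | (gdist E o xy.1 < gdist E o xy.2)%N].
have ur : uniq r.
  apply: filter_uniq; apply: allpairs_uniq_dep => //.
  - exact: uniq_ball.
  - by move=> x _; exact: uniq_nbrs.
  - by move=> [x y] [x' y'] _ _ /= [-> ->].
rewrite -(@fsbig_widen _ _ _ _ [set` r]).
- rewrite -fsbig_seq// big_filter big_mkcond big_allpairs_dep.
  by apply: eq_bigr => x _; rewrite [RHS]big_mkcond.
- move=> [x y] /=; rewrite mem_filter/= => /andP[xy /allpairsPdep[x' [y' [+ _ [xx _]]]]].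
  by rewrite -xx mem_ball.
- move=> [x y] [/= [xn xy]] nr; apply/eqP/negPn/negP => muxy; apply: nr.
  rewrite mem_filter xy/=; apply/allpairsPdep; exists x, y; rewrite mem_ball mem_nbrs xn.
  by split=> //; apply/muE; rewrite lt_neqAle eq_sym muxy mu0.
Qed.

(** Pairs inside the ball cancel by antisymmetry. A neighbour outside the ball forces [x] onto the
    sphere, as distance changes by at most one along an edge. *)
Lemma green_ball o n (F : V -> V -> R) :
  (forall x y, F x y = - F y x) -> (forall x y, ~~ E x y -> F x y = 0) ->
  \sum_(x <- ball E o n) \sum_(y <- nbrs E x) F x y =
  \sum_(x <- ball E o n | gdist E o x == n)
     \sum_(y <- nbrs E x | (gdist E o x < gdist E o y)%N) F x y.
Proof.
move=> asF offF.
have inner : \sum_(x <- ball E o n)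
    \sum_(y <- nbrs E x | (gdist E o y <= n)%N) F x y = 0.
  (* Extending by zero off the edges gives a sum over the full square of the ball, where exchanging
     the variables changes the sign. *)
  transitivity (\sum_(x <- ball E o n) \sum_(y <- ball E o n) F x y).
    apply: eq_bigr => x _; rewrite [RHS](bigID (E x)) /= [X in _ = _ + X]big1 ?addr0; last by move=> y /offF.
    rewrite -big_filter -[RHS]big_filter; apply: perm_big.
    apply: uniq_perm; rewrite ?filter_uniq ?uniq_nbrs ?uniq_ball// => y.
    by rewrite !mem_filter mem_nbrs mem_ball andbC.
  set S := \sum_(x <- _) _.
  have : S = - S.
    rewrite {1}/S exchange_big /= /S -sumrN; apply: eq_bigr => x _.
    by rewrite -sumrN; apply: eq_bigr => y _; exact: asF.
  by move=> SN; lra.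
rewrite -[RHS]add0r -[X in _ = X + _]inner.
under eq_bigr => x _ do rewrite (bigID (fun y => (gdist E o y <= n)%N)) /=.
rewrite big_split /=; congr (_ + _).
rewrite [RHS]big_mkcond [LHS]big_seq [RHS]big_seq; apply: eq_bigr => x.
rewrite mem_ball => xn; case: eqP => [<-|nx].
  by apply: eq_bigl => y; rewrite ltnNge.
rewrite big_seq_cond big1// => y; rewrite mem_nbrs => /andP[xy].
by have := gdist_edge o xy; lia.
Qed.


(** Green's formula bounds the ball energy by the flux leaving the sphere, and Young is applied edge
    by edge. Keeping [t] free replaces Hoelder's inequality on the sphere. *)
Lemma supersolution_flow (v : V -> R) (c m s : R) o n t :
  is_weight E mu -> 1 < m -> 0 < s -> 0 < c -> 0 < t ->
  let q := (m - 1) * (1 + s) in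
  let I k := c * \sum_(x <- ball E o k) energy q v x in
  (forall x, c * energy q v x <= flux m v x) ->
  (1 + s) * t `^ s * I n.+1 <= c^-1 * (I n.+1 - I n) + s * t `^ (1 + s) *
    \sum_(x <- ball E o n.+1 | gdist E o x == n.+1) out_weight o x.
Proof.
move=> [muC [mu0 muE]] m1 s0 c0 t0 q I super.
(* The choice of [q] makes [|d|^q] the power [1 + s] of [|d|^(m-1)]. *)
have young x y : (1 + s) * t `^ s * pflux m (v x - v y) <=
    `|v x - v y| `^ q + s * t `^ (1 + s).
  rewrite /q powRrM; apply: le_trans (powR_young s0 (powR_ge0 _ _) t0).
  rewrite ler_wpM2l ?mulr_ge0 ?powR_ge0 ?addr_ge0 ?(ltW s0)//.
  by rewrite -pflux_ge0E// le_pflux// ler_norm.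
have green : I n.+1 <= \sum_(x <- ball E o n.+1 | gdist E o x == n.+1)
    \sum_(y <- nbrs E x | (gdist E o x < gdist E o y)%N) mu x y * pflux m (v x - v y).
  rewrite -green_ball.
  - by rewrite /I mulr_sumr ler_sum// => x _; exact: super.
  - by move=> x y; rewrite muC -opprB pfluxN mulrN.
  - move=> x y /negP nxy; rewrite (_ : mu x y = 0) ?mul0r//.
    by apply/eqP/negPn/negP => h; apply/nxy/muE; rewrite lt_neqAle eq_sym h mu0.
have s10 : 0 <= (1 + s) * t `^ s.
  by rewrite mulr_ge0 ?powR_ge0// addr_ge0// ltW.
apply: le_trans (ler_wpM2l s10 green) _.
have -> : I n.+1 - I n =
    c * \sum_(x <- ball E o n.+1 | gdist E o x == n.+1) energy q v x.
  by rewrite /I sum_ballS mulrDr addrAC subrr add0r.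
rewrite mulKf ?gt_eqF//.
rewrite !mulr_sumr -big_split /=; apply: ler_sum => x _.
apply: (@le_trans _ _ (\sum_(y <- nbrs E x | (gdist E o x < gdist E o y)%N)
    mu x y * `|v x - v y| `^ q + s * t `^ (1 + s) *
    \sum_(y <- nbrs E x | (gdist E o x < gdist E o y)%N) mu x y)); last first.
  rewrite lerD2r [leRHS](bigID (fun y => gdist E o x < gdist E o y)%N) /=.
  by rewrite lerDl sumr_ge0// => y _; rewrite mulr_ge0 ?powR_ge0.
rewrite !mulr_sumr -big_split /=; apply: ler_sum => y _.
by rewrite mulrCA (mulrC _ (mu x y)) -mulrDr ler_wpM2l.
Qed.

(** * Flux bounds for solutions and their truncations *)

(** By [cond_p0] the single edge [xy] has coefficient at least [1 / (2 p0)] in the squared gradient;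
    the other terms are nonnegative. *)
Lemma gradn_ge_diff (u : V -> R) (p0 : R) x y :
  is_weight E mu -> cond_p0 E mu p0 -> E x y ->
  `|u x - u y| <= Num.sqrt (2 * p0) * gradn E mu u x.
Proof.
move=> [_ [mu0 _]] [p01 p0E] xy; have p00 : 0 < p0 by lra.
have vm0 : 0 <= vmeas E mu x by rewrite fsumr_ge0.
rewrite /gradn -sqrtrM ?mulr_ge0 ?(ltW p00)//.
rewrite -sqrtr_sqr ler_wsqrtr//.
rewrite fsbig_finite; last exact: finE.
rewrite -/(nbrs E x) (bigD1_seq y) ?uniq_nbrs ?mem_nbrs//=.
set S := \sum_(_ <- _ | _) _.
have S0 : 0 <= S.
  by rewrite sumr_ge0// => z _; rewrite mulr_ge0 ?sqr_ge0// divr_ge0// mulr_ge0.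
have := p0E _ _ xy; set r := mu x y / _ => hr.
have -> : mu x y / (2 * vmeas E mu x) = r / 2 by rewrite invfM mulrA mulrAC.
have : 1 <= p0 * r.
  by have := ler_wpM2l (ltW p00) hr; rewrite mulrCA divff ?mulr1 ?gt_eqF.
move=> /(ler_wpM2l (sqr_ge0 (u y - u x))).
have := mulr_ge0 (ltW p00) S0; rewrite -sqrrN opprB.
by move: ((u y - u x) ^+ 2) => d; lra.
Qed.

Lemma solution_flux (u : V -> R) (p0 m p q : R) x :
  is_weight E mu -> cond_p0 E mu p0 -> 0 < q ->
  mlap E mu m u x + u x `^ p * gradn E mu u x `^ q <= 0 ->
  (Num.sqrt (2 * p0) `^ q)^-1 * u x `^ p * energy q u x <= flux m u x.
Proof.
move=> wmu cp0 q0; have [_ [mu0 muE]] := wmu; have [p01 _] := cp0.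
have vmE : vmeas E mu x = \sum_(y <- nbrs E x) mu x y.
  by rewrite /vmeas fsbig_finite//; exact: finE.
rewrite /mlap fsbig_finite; last exact: finE.
rewrite -/(nbrs E x).
have -> : \sum_(y <- nbrs E x) mu x y * (`|u y - u x| `^ (m - 2) * (u y - u x)) =
    - flux m u x.
  by rewrite -sumrN; apply: eq_bigr => y _; rewrite -mulrN -pfluxN opprB.
set F := flux m u x.
(* Without neighbours the vertex measure is 0 and cannot be divided out; both sides are then empty
   sums. *)
case: (pselect (exists y, E x y)) => [[y0 xy0]|nbr0]; last first.
  rewrite /energy /F /flux !big_seq !big1 ?mulr0// => y; rewrite mem_nbrs => xy.
  - by case: nbr0; exists y.
  - by case: nbr0; exists y.
have vm0 : 0 < vmeas E mu x.
  rewrite vmE (bigD1_seq y0) ?uniq_nbrs ?mem_nbrs//=.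
  by apply: ltr_wpDr; [exact: sumr_ge0|exact/muE].
set g := gradn _ _ _ _ `^ q => sol.
have c0 : 0 < Num.sqrt (2 * p0) `^ q.
  by rewrite powR_gt0// sqrtr_gt0; lra.
have sol' : vmeas E mu x * (u x `^ p * g) <= F.
  have : u x `^ p * g <= (vmeas E mu x)^-1 * F by lra.
  by rewrite -(ler_pM2l vm0) [leRHS]mulrA divff ?mul1r// gt_eqF.
apply: le_trans sol'.
have grad : energy q u x <=
    vmeas E mu x * (Num.sqrt (2 * p0) `^ q * g).
  rewrite vmE mulr_suml /energy [leLHS]big_seq [leRHS]big_seq; apply: ler_sum => y.
  rewrite mem_nbrs => xy; rewrite ler_wpM2l// /g -powRM ?sqrtr_ge0//.
  apply: ge0_ler_powR; rewrite ?nnegrE ?mulr_ge0 ?sqrtr_ge0//; first exact: ltW.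
  exact: gradn_ge_diff.
have h : 0 <= (Num.sqrt (2 * p0) `^ q)^-1 * u x `^ p.
  by rewrite mulr_ge0 ?powR_ge0// invr_ge0 ltW.
apply: le_trans (ler_wpM2l h grad) _; rewrite le_eqVlt; apply/orP; left.
by apply/eqP; field; rewrite gt_eqF.
Qed.

Lemma truncated_flux (u v : V -> R) (c0 m p q M : R) x :
  is_weight E mu -> 1 < m -> p <= 0 -> m - 1 <= q -> 0 < c0 -> 0 < M ->
  (forall y, 0 < u y) -> (forall y, v y = Num.min (u y) M) ->
  c0 * u x `^ p * energy q u x <= flux m u x ->
  Num.min (c0 * M `^ p) (M `^ (m - 1 - q)) * energy q v x <= flux m v x.
Proof.
move=> [_ [mu0 _]] m1 p0 mq c00 M0 u0 vE superu.
have q0 : 0 <= q by lra.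
have e0 f : 0 <= energy q f x.
  by rewrite sumr_ge0// => y _; rewrite mulr_ge0 ?powR_ge0.
have v0 y : 0 < v y by rewrite vE lt_min u0.
have [uxM|uxM] := leP (u x) M.
  (* Truncation keeps [v x = u x] and lowers the neighbours, so the flux can only grow, while the
     energy shrinks because [min] with [M] is 1-Lipschitz. *)
  have vx : v x = u x by rewrite vE min_l.
  apply: (@le_trans _ _ (flux m u x)).
    apply: le_trans superu.
    apply: (@le_trans _ _ (c0 * M `^ p * energy q v x)).
      by rewrite ler_wpM2r ?e0// ge_min lexx.
    apply: ler_pM; rewrite ?e0 ?mulr_ge0 ?powR_ge0 ?(ltW c00)//.
      rewrite ler_wpM2l ?(ltW c00)// -[p]opprK !(powRN _ (- p)).
      rewrite lef_pV2 ?posrE ?powR_gt0//.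
      by rewrite ge0_ler_powR ?nnegrE ?oppr_ge0// ltW.
    apply: ler_sum => y _; rewrite ler_wpM2l// ge0_ler_powR ?nnegrE//.
    rewrite vx vE; have [|uyM] := leP (u y) M; first by [].
    by rewrite -normrN -[leRHS]normrN !ger0_norm; lra.
  apply: ler_sum => y _; rewrite ler_wpM2l// le_pflux// vx lerD2l lerN2.
  by rewrite vE ge_min lexx.
have vx : v x = M by rewrite vE min_r// ltW.
apply: (@le_trans _ _ (M `^ (m - 1 - q) * energy q v x)).
  by rewrite ler_wpM2r ?e0// ge_min lexx orbT.
rewrite mulr_sumr; apply: ler_sum => y _; rewrite mulrCA ler_wpM2l//.
have vyM : v y <= M by rewrite vE ge_min lexx orbT.
have d0 : 0 <= v x - v y by lra.
rewrite ger0_norm// pflux_ge0E//; move: d0; rewrite le_eqVlt => /predU1P[<-|d0].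
  by rewrite !powR0 ?mulr0//; lra.
(* The exponent [m - 1 - q] is at most 0, so on [(0, M]] the first factor is smallest at [M]. *)
have -> : (v x - v y) `^ (m - 1) = (v x - v y) `^ (m - 1 - q) * (v x - v y) `^ q.
  by rewrite -powRD ?subrK// (gt_eqF d0) implybT.
rewrite ler_wpM2r ?powR_ge0// -[m - 1 - q]opprK !(powRN _ (- _)).
rewrite lef_pV2 ?posrE ?powR_gt0// ge0_ler_powR ?nnegrE ?(ltW d0) ?(ltW M0)//.
  by lra.
by have := v0 y; lra.
Qed.

End Weight.

(** * Nonconstancy and the final contradiction *)

(** Otherwise, by symmetry of [E], [u] agrees across every edge and hence along any walk from [x] to
    [y]. *)
Lemma nonconstant_edge (R : realType) (u : V -> R) :
  (exists x y, u x != u y) -> exists x y, E x y /\ u x < u y.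
Proof.
move=> [x [y uxy]]; have [_ EC] := simpE.
have [//|nedge] := pselect (exists x y, E x y /\ u x < u y).
have const x' y' : E x' y' -> u x' = u y'.
  move=> xy; apply/eqP; rewrite eq_le !leNgt; apply/andP; split; apply/negP => h.
    by apply: nedge; exists y', x'; rewrite EC.
  by apply: nedge; exists x', y'.
have [k [s [_ [ps ls]]]] := connE x y.
suff : u x = u (last x s) by move=> e; rewrite e ls eqxx in uxy.
elim: s x ps {ls uxy} => [//|z s IH] x /= /andP[xz /IH <-].
exact: const.
Qed.

End Graph.

Theorem theorem1p1 (V : choiceType) (E : rel V) (R : realType) (mu : V -> V -> R)
  (p0 m p q C : R) (o : V) (n1 : nat) :
  simple_graph E -> connected_graph E -> locally_finite E -> infinite_graph V ->
  is_weight E mu -> cond_p0 E mu p0 ->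
  1 < m -> p < 0 -> m - 1 < q -> q < m ->
  0 < C ->
  (forall n : nat, (n1 <= n)%N ->
     Wvol E mu o n <= C * (n%:R `^ (q / (q - m + 1))) *
                          (ln (n%:R : R)) `^ ((m - 1) / (q - m + 1))) ->
  ~ exists u : V -> R, nontriv_pos_sol E mu m p q u.
Proof.
move=> simpE connE finE _ wmu cp0 m1 p_lt0 mq _ C0 growth [u [u0 [unc sol]]].
have [_ [mu0 muE]] := wmu; have [p01 _] := cp0.
have q0 : 0 < q by lra.
have m10 : 0 < m - 1 by lra.
have [a [b [ab uab]]] := nonconstant_edge simpE connE unc.
(* Truncating at the larger end of a strictly increasing edge keeps [v a < v b], so the energy is
   positive from radius [gdist E o a] on. *)
pose M := u b; pose v y := Num.min (u y) M.
pose c := Num.min ((Num.sqrt (2 * p0) `^ q)^-1 * M `^ p) (M `^ (m - 1 - q)).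
have sq0 : 0 < (Num.sqrt (2 * p0) `^ q)^-1.
  by rewrite invr_gt0 powR_gt0// sqrtr_gt0; lra.
have M0 : 0 < M by exact: u0.
have c0 : 0 < c by rewrite lt_min mulr_gt0 ?powR_gt0.
have super x : c * energy E mu q v x <= flux E mu m v x.
  apply: truncated_flux (solution_flux finE wmu cp0 q0 (sol x)) => //; exact: ltW.
(* Chosen so that [(1 + s) / s] and [1 / s] are the two exponents of the volume bound. *)
pose s := q / (m - 1) - 1.
have qE : q = (m - 1) * (1 + s) by rewrite /s; field; rewrite gt_eqF.
have s0 : 0 < s by rewrite subr_gt0 ltr_pdivlMr// mul1r.
pose e := energy E mu q v.
have e0 x : 0 <= e x by rewrite sumr_ge0// => y _; rewrite mulr_ge0 ?powR_ge0.
apply: (@flow_growth_false R s c^-1 C (fun n => c * \sum_(x <- ball E o n) e x)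
  (fun n => \sum_(x <- ball E o n | gdist E o x == n) out_weight E mu o x)
  (gdist E o a) n1) => //.
- by rewrite invr_gt0.
- by move=> n; rewrite ler_wpM2l ?(ltW c0)// sum_ballS// lerDl sumr_ge0.
- rewrite mulr_gt0// (bigD1_seq a) ?uniq_ball ?mem_ball//=.
  apply: ltr_wpDr; first exact: sumr_ge0.
  rewrite /e /energy (bigD1_seq b) ?uniq_nbrs ?mem_nbrs//=.
  apply: ltr_wpDr; first by rewrite sumr_ge0// => y _; rewrite mulr_ge0 ?powR_ge0.
  rewrite mulr_gt0 ?powR_gt0//; first exact/muE.
  by rewrite normr_gt0 /v /M minxx min_l ?(ltW uab)// subr_eq0 lt_eqF.
- by move=> n; rewrite sumr_ge0// => x _; rewrite sumr_ge0.
- by move=> n t t0; rewrite /e qE; apply: supersolution_flow => //; rewrite -qE.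
move=> n /growth; rewrite Wvol_spheres//.
have -> : (1 + s) / s = q / (q - m + 1).
  by rewrite /s; field; rewrite !gt_eqF//; lra.
have -> : 1 / s = (m - 1) / (q - m + 1).
  by rewrite /s; field; rewrite !gt_eqF//; lra.
by [].
Qed.
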